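(* Let $X$ be a Banach space, $T:X\rightrightarrows X^*$ and $K:X\rightrightarrows X$ set-valued maps. Suppose that $K$ is locally reproducible at a fixed point $z\in FP(K)$ and that a neighbourhood of reproducibility at $z$ contains an element $\bar x$ of $LMVI(T,K(z))$. Then $\bar x\in LMQVI(T,K)$. As a consequence, if $K$ is locally reproducible at every $z\in FP(K)$, with neighbourhood of reproducibility $U_z$ at $z$, then $$LMQVI(T,K)=\bigcup_{z\in FP(K)}LMVI(T,K(z)\cap U_z).$$
   Context: $FP(K)=\{x\in X: x\in K(x)\}$; $\langle\cdot,\cdot\rangle$ is the duality pairing on $X^*\times X$. A neighbourhood of a point is any set containing an open set that contains the point. $K$ is locally reproducible at $z\in FP(K)$ if there is a neighbourhood $U$ of $z$ such that $K(z)\cap U=K(u)\cap U$ for every $u\in K(z)\cap U$; such a $U$ is called a neighbourhood of reproducibility at $z$. $LMVI(T,C)$, for $C\subset X$: the set of $\bar x\in C$ for which there is a neighbourhood $U$ of $\bar x$ with $\langle y^*,y-\bar x\rangle\ge0$ for all $y\in C\cap U$ and all $y^*\in T(y)$. $LMQVI(T,K)$: the set of $\bar x\in X$ with $\bar x\in K(\bar x)$ for which there is a neighbourhood $U$ of $\bar x$ with $\langle y^*,y-\bar x\rangle\ge0$ for all $y\in K(\bar x)\cap U$ and all $y^*\in T(y)$.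
   Formalization: The claim fails if x̄ may lie on the boundary of the neighbourhood of reproducibility; the formal theorem assumes that this neighbourhood is also one of x̄, and in the second part that U_z is a neighbourhood of every point of K(z)∩U_z (automatic when U_z is open). *)

(* Defs.v *)
From HB Require Import structures.
From mathcomp Require Import all_boot all_order all_algebra.
From mathcomp Require Import all_classical all_reals.
From mathcomp Require Import topology normedtype.

Set Implicit Arguments.
Unset Strict Implicit.
Unset Printing Implicit Defensive.
Import Order.TTheory GRing.Theory Num.Theory.
Import numFieldNormedType.Exports.
Local Open Scope classical_set_scope.
Local Open Scope ring_scope.

(* The topological dual X^*; the coercion to functions makes [ys x] the
   duality pairing of [ys : dual X] and [x : X]. *)
Record dual (R : realType) (X : normedModType R) := Dual {
  dual_fun :> {linear X -> R^o};
  dual_continuous : continuous dual_fun }.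

Definition FP (X : Type) (K : X -> set X) : set X := [set x | K x x].

(* As usual with [nbhs], a neighbourhood need not be open. *)
Definition reproducibility_nbhd (X : topologicalType) (K : X -> set X)
    (z : X) (U : set X) : Prop :=
  nbhs z U /\ forall u, (K z `&` U) u -> K z `&` U = K u `&` U.

Definition LMVI (R : realType) (X : normedModType R)
    (T : X -> set (dual X)) (C : set X) : set X :=
  [set xbar | C xbar /\ exists U : set X, nbhs xbar U /\
     forall y, (C `&` U) y -> forall ys, T y ys -> 0 <= ys (y - xbar)].

Definition LMQVI (R : realType) (X : normedModType R)
    (T : X -> set (dual X)) (K : X -> set X) : set X :=
  [set xbar | K xbar xbar /\ exists U : set X, nbhs xbar U /\
     forall y, (K xbar `&` U) y -> forall ys, T y ys -> 0 <= ys (y - xbar)].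

(* Main.v *)
Require Import Defs.
From HB Require Import structures.
From mathcomp Require Import all_boot all_order all_algebra.
From mathcomp Require Import all_classical all_reals.
From mathcomp Require Import topology normedtype.

Set Implicit Arguments.
Unset Strict Implicit.
Unset Printing Implicit Defensive.
Import Order.TTheory GRing.Theory Num.Theory.
Import numFieldNormedType.Exports.
Local Open Scope classical_set_scope.
Local Open Scope ring_scope.

(** Being a local Minty solution at [x] depends only on the constraint set near [x]: it passes to
    subsets containing [x] ([LMVI_sub]) and back from C ∩ U to C when U is a neighbourhood of [x]
    ([LMVI_local]). Reproducibility at [z] says that [K z] and [K x] agree on U, so a solution for
    [K z] is one for [K x]. *)

Lemma LMVI_local (R : realType) (X : normedModType R)
    (T : X -> set (dual X)) (C U : set X) (x : X) :
  nbhs x U -> LMVI T (C `&` U) x -> LMVI T C x.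
Proof.
move=> Ux [[Cx _] [V [Vx HV]]]; split=> //.
exists (U `&` V); split; first exact: filterI.
by move=> y [Cy [Uy Vy]]; apply: HV.
Qed.

Lemma LMVI_sub (R : realType) (X : normedModType R)
    (T : X -> set (dual X)) (C D : set X) (x : X) :
  D `<=` C -> D x -> LMVI T C x -> LMVI T D x.
Proof.
move=> DC Dx [_ [V [Vx HV]]]; split=> //.
by exists V; split=> // y [Dy Vy]; apply: HV; split=> //; apply: DC.
Qed.

(** [nbhs x U] is stronger than membership: if U merely contained [x], then [K x] could have points
    outside U arbitrarily close to [x], where nothing is known. *)
Lemma LMVI_LMQVI (R : realType) (X : normedModType R)
    (T : X -> set (dual X)) (K : X -> set X) (z : X) (U : set X) (x : X) :
  reproducibility_nbhd K z U -> nbhs x U -> LMVI T (K z) x -> LMQVI T K x.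
Proof.
move=> [_ KU] Ux Hx.
have KzUx : (K z `&` U) x by split; [case: Hx | exact: nbhs_singleton].
have : LMVI T (K z `&` U) x by apply: LMVI_sub Hx.
(* [LMQVI T K x] is [LMVI T (K x) x] by unfolding, so it remains to drop U from K x ∩ U. *)
by rewrite (KU x KzUx); apply: LMVI_local.
Qed.

Theorem proposition3p5 (R : realType) (X : completeNormedModType R)
    (T : X -> set (dual X)) (K : X -> set X) :
  (forall (z : X) (U : set X) (xbar : X),
      FP K z ->
      reproducibility_nbhd K z U ->
      nbhs xbar U ->
      LMVI T (K z) xbar ->
      LMQVI T K xbar) /\
  (forall U : X -> set X,
      (forall z, FP K z -> reproducibility_nbhd K z (U z)) ->
      (forall z, FP K z -> forall u, (K z `&` U z) u -> nbhs u (U z)) ->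
      LMQVI T K = \bigcup_(z in FP K) LMVI T (K z `&` U z)).
Proof.
split=> [z U x _ HU Ux Hx|U HU Uint]; first exact: LMVI_LMQVI HU Ux Hx.
apply/seteqP; split=> [x Hx|x [z Kz Hx]].
  have Kx : FP K x by case: Hx.
  (* A quasi-variational solution is itself a fixed point, so it serves as its own index [z]. *)
  exists x => //; apply: LMVI_sub Hx => //.
  by split=> //; apply: nbhs_singleton; case: (HU x Kx).
(* [Uint] applies since [x] lies in K z ∩ U z; open sets [U z] would satisfy it automatically. *)
have Ux : nbhs x (U z) by apply: Uint => //; case: Hx.
exact: LMVI_LMQVI (HU z Kz) Ux (LMVI_local Ux Hx).
Qed.
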